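(* Let $F$ be a field (of arbitrary characteristic). Any two countably generated symplectic vector spaces over $F$ of the same dimension $n=2r$, $r\in\{1,2,\dots,\infty\}$, are congruent.
   Context: A vector space $V$ over $F$ is countably generated if there is a sequence $v_1,v_2,\dots\in V$ such that every element of $V$ is a finite linear combination of the $v_k$; $n=\infty$ means countably infinite dimension. A bilinear form $B:V\times V\to F$ is skew-symmetric if $B(x,y)=-B(y,x)$ and $B(x,x)=0$ for all $x,y\in V$ (the second condition follows from the first if $\operatorname{char}F\neq 2$). It is symplectic if it is skew-symmetric and its kernel $\{x\in V: B(x,V)=\{0\}\}$ is $\{0\}$. A symplectic vector space is a pair $(V,B)$ consisting of a countably generated vector space $V$ over $F$ and a symplectic bilinear form $B$ on $V$. Two symplectic vector spaces $(V,B)$, $(V',B')$ over $F$ are congruent if there is a linear isomorphism $T:V\to V'$ with $B'(Tx,Ty)=B(x,y)$ for all $x,y\in V$. *)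

(* Defs.v *)
From HB Require Import structures.
From mathcomp Require Import all_boot all_algebra.
Set Implicit Arguments.
Unset Strict Implicit.
Unset Printing Implicit Defensive.
Import GRing.Theory.
Local Open Scope ring_scope.

(* The library's vectType only covers finite dimension, so vector spaces are
   arbitrary lmodTypes over a field. *)

Definition spanning (F : fieldType) (V : lmodType F) (I : eqType) (e : I -> V)
    : Prop :=
  forall x : V, exists (s : seq I) (a : I -> F), x = \sum_(i <- s) a i *: e i.

Definition lin_indep (F : fieldType) (V : lmodType F) (I : eqType) (e : I -> V)
    : Prop :=
  forall (s : seq I) (a : I -> F), uniq s ->
    \sum_(i <- s) a i *: e i = 0 -> forall i, i \in s -> a i = 0.

Definition is_basis (F : fieldType) (V : lmodType F) (I : eqType) (e : I -> V)
    : Prop :=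
  spanning e /\ lin_indep e.

Definition countably_generated (F : fieldType) (V : lmodType F) : Prop :=
  exists v : nat -> V, spanning v.

(* Elements of {0, 1, 2, ...} together with (countable) infinity. *)
Variant xdim : Type := Fin of nat | Infty.

Definition xdim_double (r : xdim) : xdim :=
  match r with Fin k => Fin k.*2 | Infty => Infty end.

Definition has_dim (F : fieldType) (V : lmodType F) (n : xdim) : Prop :=
  match n with
  | Fin k => exists e : 'I_k -> V, is_basis e
  | Infty => exists e : nat -> V, is_basis e
  end.

(* The second condition is not redundant in characteristic 2, where the
   library's {skew_symmetric V} only gives the first. *)
Definition skew_symmetric (F : fieldType) (V : lmodType F) (B : {biscalar V})
    : Prop :=
  (forall x y : V, B x y = - B y x) /\ (forall x : V, B x x = 0).

Definition in_kernel (F : fieldType) (V : lmodType F) (B : {biscalar V})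
    (x : V) : Prop :=
  forall y : V, B x y = 0.

Definition symplectic (F : fieldType) (V : lmodType F) (B : {biscalar V})
    : Prop :=
  skew_symmetric B /\ (forall x : V, in_kernel B x <-> x = 0).

Definition symplectic_space (F : fieldType) (V : lmodType F) (B : {biscalar V})
    : Prop :=
  countably_generated V /\ symplectic B.

Definition congruent (F : fieldType) (V V' : lmodType F)
    (B : {biscalar V}) (B' : {biscalar V'}) : Prop :=
  exists T : {linear V -> V'},
    bijective T /\ forall x y : V, B' (T x) (T y) = B x y.

(* Main.v *)
Require Import Defs.
From HB Require Import structures.
From mathcomp Require Import all_boot all_algebra.
From mathcomp Require Import boolp.
Import GRing.Theory.
Local Open Scope ring_scope.

(** Gram-Schmidt for alternating forms: if hyperbolic pairs e_i, f_i (i < m) do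
    not span v, then w = v - proj v is orthogonal to all of them, and a vector
    y with B w y <> 0 gives, after projecting and rescaling, a partner of w.
    Always applying this to the first unspanned vector of a basis produces a
    symplectic basis.  In dimension 2k the procedure can be run exactly k
    times, in infinite dimension it never stops.  Two spanning families with
    the same Gram matrix for nondegenerate forms determine a congruence. *)

(** * Generating families and congruences from Gram data *)

(** Spanning is phrased as an induction principle over the generators, so that linear properties are
    checked without handling finite sums. *)
Definition generates {F : fieldType} {V : lmodType F} {J : Type} (g : J -> V)
    : Prop :=
  forall P : V -> Prop, P 0 ->
    (forall a x y, P x -> P y -> P (a *: x + y)) ->
    (forall j, P (g j)) -> forall x, P x.

Lemma closed_sum {F : fieldType} {V : lmodType F} {I : Type} (P : V -> Prop)
    (P0 : P 0) (Plin : forall a x y, P x -> P y -> P (a *: x + y))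
    (s : seq I) (a : I -> F) (e : I -> V) :
  (forall i, P (e i)) -> P (\sum_(i <- s) a i *: e i).
Proof.
move=> Pe; elim: s => [|i s IHs]; first by rewrite big_nil.
by rewrite big_cons; apply: Plin.
Qed.

Lemma spanning_generates {F : fieldType} {V : lmodType F} {I : eqType}
    (e : I -> V) : spanning e -> generates e.
Proof.
by move=> span_e P P0 Plin Pe x; have [s [a ->]] := span_e x; apply: closed_sum.
Qed.

(** The difference is orthogonal to the generators, hence to everything, so it lies in the
    kernel. *)
Lemma symplectic_eq {F : fieldType} {V : lmodType F} {B : {biscalar V}}
    {J : Type} {g : J -> V} (sB : symplectic B) (gen_g : generates g) (x y : V) :
  (forall j, B x (g j) = B y (g j)) -> x = y.
Proof.
move=> eq_xy; apply/eqP; rewrite -subr_eq0; apply/eqP.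
apply/(proj2 sB); apply: gen_g => [|a u v Hu Hv|j]; first exact: linear0r.
  by rewrite linearPr /= Hu Hv mulr0 addr0.
by rewrite linearBl /= eq_xy subrr.
Qed.

(** The map sends [x] to the vector whose pairings with [g'] are those of [x] with [g]. Induction
    over the generators gives existence; nondegeneracy gives uniqueness, from which linearity and
    bijectivity follow. *)
Lemma congruent_of_gram {F : fieldType} {V V' : lmodType F}
    {B : {biscalar V}} {B' : {biscalar V'}} {J : Type}
    {g : J -> V} {g' : J -> V'}
    (sB : symplectic B) (sB' : symplectic B')
    (gen_g : generates g) (gen_g' : generates g') :
  (forall i j, B (g i) (g j) = B' (g' i) (g' j)) -> congruent B B'.
Proof.
move=> gram.
have trans (U U' : lmodType F) (C : {biscalar U}) (C' : {biscalar U'})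
    (u : J -> U) (u' : J -> U') : generates u ->
    (forall i j, C (u i) (u j) = C' (u' i) (u' j)) ->
    exists f, forall x j, C' (f x) (u' j) = C x (u j).
  move=> gen_u gramC.
  suff /choice [f Hf] : forall x, exists y, forall j,
    C' y (u' j) = C x (u j) by exists f.
  apply: gen_u => [|a x1 x2 [y1 H1] [y2 H2]|i].
  - by exists 0 => j; rewrite !linear0l.
  - by exists (a *: y1 + y2) => j; rewrite !linearPl /= H1 H2.
  - by exists (u' i) => j; rewrite gramC.
have [f Hf] := trans V V' B B' g g' gen_g gram.
(* Transfer in the opposite direction provides the inverse of [f]. *)
have [f' Hf'] := trans V' V B' B g' g gen_g' (fun i j => esym (gram i j)).
have lin_f : linear f.
  move=> a x y; apply: (symplectic_eq sB' gen_g') => j.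
  by rewrite linearPl /= !Hf linearPl.
pose T : {linear V -> V'} := HB.pack f (GRing.isLinear.Build F V V' *:%R f lin_f).
exists T; split.
  exists f' => x.
    by apply: (symplectic_eq sB gen_g) => j; rewrite Hf' Hf.
  by apply: (symplectic_eq sB' gen_g') => j; rewrite Hf Hf'.
have Tg j : f (g j) = g' j.
  by apply: (symplectic_eq sB' gen_g') => i; rewrite Hf.
move=> x; apply: gen_g => [|a y z Hy Hz|j] /=.
- by rewrite (linear0 T : f 0 = 0) !linear0r.
- by rewrite lin_f !linearPr /= Hy Hz.
- by rewrite Tg Hf.
Qed.

(** * Dimension counts, hyperbolic families and symplectic projection *)

(** With more rows than columns, the Gram matrix [A] has a nonzero left kernel vector; its entries
    are coefficients excluded by the hypothesis. *)
Lemma card_leq_of_pairing {F : fieldType} {V : lmodType F} {B : {biscalar V}}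
    {I J : finType} (u : I -> V) (w : J -> V) :
  (forall c : I -> F, (forall j, B (\sum_i c i *: u i) (w j) = 0) ->
     forall i, c i = 0) ->
  (#|I| <= #|J|)%N.
Proof.
move=> Huw; rewrite leqNgt; apply/negP => ltJI.
pose A : 'M[F]_(#|I|, #|J|) := \matrix_(i, j) B (u (enum_val i)) (w (enum_val j)).
have : kermx A != 0.
  rewrite -mxrank_eq0 mxrank_ker -lt0n subn_gt0.
  exact: leq_ltn_trans (rank_leq_col A) ltJI.
case/matrix0Pn => r [i0 /negP]; apply; apply/eqP.
rewrite -(enum_valK i0); pose c i := kermx A r (enum_rank i).
apply: (Huw c) => j; rewrite linear_sumlz /=.
have /matrixP/(_ r (enum_rank j)) := mulmx_ker A; rewrite !mxE => {2}<-.
rewrite (reindex _ (onW_bij _ (enum_val_bij I))) /=.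
apply: eq_bigr => i _.
by rewrite linearZl_LR /= /c enum_valK [A _ _]mxE enum_rankK.
Qed.

(** [h i false] is e_i and [h i true] is f_i; only the values at
    indices below [m] matter. *)
Definition hyperbolic {F : fieldType} {V : lmodType F} (B : {biscalar V})
    (h : nat -> bool -> V) (m : nat) : Prop :=
  forall i j b b', (i < m)%N -> (j < m)%N ->
    B (h i b) (h j b') = if i == j then b'%:R - b%:R else 0.

(** For hyperbolic [h] this is the projection onto the span of the first [m] pairs along its
    orthogonal complement; the signs come from B(e_i, f_i) = 1 and B(f_i, e_i) = -1. *)
Definition proj {F : fieldType} {V : lmodType F} (B : {biscalar V})
    (h : nat -> bool -> V) (m : nat) (x : V) : V :=
  \sum_(i < m) (B x (h i true) *: h i false - B x (h i false) *: h i true).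

Lemma eq_hyperbolic {F : fieldType} {V : lmodType F} {B : {biscalar V}}
    {h h' : nat -> bool -> V} {m : nat} :
  (forall i, (i < m)%N -> h' i = h i) -> hyperbolic B h m -> hyperbolic B h' m.
Proof. by move=> eq_h Hh i j b b' im jm; rewrite !eq_h // Hh. Qed.

Lemma eq_proj {F : fieldType} {V : lmodType F} {B : {biscalar V}}
    {h h' : nat -> bool -> V} {m : nat} :
  (forall i, (i < m)%N -> h' i = h i) -> proj B h' m =1 proj B h m.
Proof. by move=> eq_h x; apply: eq_bigr => i _; rewrite !eq_h. Qed.

Lemma proj_perp {F : fieldType} {V : lmodType F} {B : {biscalar V}}
    {h : nat -> bool -> V} {m : nat} (x z : V) :
  (forall i b, (i < m)%N -> B (h i b) z = 0) -> B (proj B h m x) z = 0.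
Proof.
move=> Hz; rewrite linear_sumlz /= big1 // => i _.
by rewrite linearBl /= !linearZl_LR /= !Hz // !mulr0 subrr.
Qed.

Lemma proj_linear {F : fieldType} {V : lmodType F} {B : {biscalar V}}
    {h : nat -> bool -> V} {m : nat} : linear (proj B h m).
Proof.
move=> a x y; rewrite /proj scaler_sumr -big_split /=; apply: eq_bigr => i _.
rewrite !linearPl /= !scalerDl scalerBr !scalerA.
by rewrite opprD !addrA; congr (_ + _); rewrite -!addrA; congr (_ + _); rewrite addrC.
Qed.

Lemma proj_gram {F : fieldType} {V : lmodType F} {B : {biscalar V}}
    {h : nat -> bool -> V} {m : nat} (Hh : hyperbolic B h m) (x : V) j b :
  (j < m)%N -> B (proj B h m x) (h j b) = B x (h j b).
Proof.
move=> jm; rewrite linear_sumlz /= (bigD1 (Ordinal jm)) //= big1 => [|i ne_ij].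
  rewrite linearBl /= !linearZl_LR /= !Hh // eqxx addr0.
  by case: b; rewrite /= ?subrr ?subr0 ?sub0r ?mulrN ?mulr0 ?mulr1 ?oppr0 ?opprK
    ?add0r ?addr0.
rewrite linearBl /= !linearZl_LR /= !Hh //.
by move: ne_ij; rewrite -val_eqE /= => /negPf ->; rewrite !mulr0 subrr.
Qed.

(** Quantifying over every [h'] that continues [h] by [p] serves both a one-step modification of [h]
    and a sequence fixed once for all stages. *)
Lemma hyperbolic_extend {F : fieldType} {V : lmodType F} {B : {biscalar V}}
    {h : nat -> bool -> V} {m : nat} {v : V} (sB : symplectic B) :
  hyperbolic B h m -> proj B h m v != v ->
  exists p, forall h', (forall i, (i < m)%N -> h' i = h i) -> h' m = p ->
    hyperbolic B h' m.+1 /\ proj B h' m.+1 v = v.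
Proof.
move=> Hh v_out; have [[skewB altB] kerB] := sB.
pose w := v - proj B h m v.
have w_perp x i b : (i < m)%N -> B (x - proj B h m x) (h i b) = 0.
  by move=> im; rewrite linearBl /= proj_gram // subrr.
have h_perp z : (forall i b, (i < m)%N -> B z (h i b) = 0) ->
    forall x, B (proj B h m x) z = 0.
  by move=> Hz x; apply: proj_perp => i b im; rewrite skewB Hz ?oppr0.
have [y Bwy] : exists y, B w y != 0.
  apply: contrapT => noy; case/negP: v_out; rewrite eq_sym -subr_eq0; apply/eqP.
  by apply/kerB => y; apply: contrapT => /eqP By; apply: noy; exists y.
(* Since [w] is orthogonal to the old pairs, removing the projection of [y] leaves B(w, y)
   unchanged, and the scalar normalizes it to 1. *)
pose f := (B w y)^-1 *: (y - proj B h m y).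
have f_perp i b : (i < m)%N -> B f (h i b) = 0.
  by move=> im; rewrite linearZl_LR /= w_perp ?mulr0.
have Bwf : B w f = 1.
  rewrite linearZr_LR /= linearBr /= [B w (proj _ _ _ _)]skewB h_perp.
    by rewrite oppr0 subr0 mulVf.
  by move=> *; apply: w_perp.
pose p b := if b then f else w; exists p => h' eq_h h'm.
have p_perp b j b' : (j < m)%N -> B (p b) (h j b') = 0.
  by case: b => jm; [apply: f_perp | apply: w_perp].
have Bpp b b' : B (p b) (p b') = b'%:R - b%:R.
  by case: b b' => [] []; rewrite /= ?altB ?subrr ?Bwf ?subr0 // skewB Bwf sub0r.
split.
  move=> i j b b'; rewrite !ltnS (leq_eqVlt i) (leq_eqVlt j).
  have [-> _|ne_im /= im] := eqVneq i m; have [-> _|ne_jm /= jm] := eqVneq j m.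
  - by rewrite h'm ?eqxx.
  - by rewrite h'm eq_h // p_perp // ?[m == j]eq_sym ?(negPf ne_jm).
  - by rewrite h'm eq_h // ?(negPf ne_im) skewB p_perp ?oppr0.
  - by rewrite !eq_h // Hh.
(* With these values the new summand of the projection of [v] is exactly [w], the part that was
   missing. *)
have Bvp b : B v (p b) = b%:R.
  have -> : v = w + proj B h m v by rewrite subrK.
  rewrite linearDl /= h_perp ?addr0; last by move=> *; apply: p_perp.
  by rewrite (Bpp false b) subr0.
rewrite /proj big_ord_recr /= -/(proj B h' m v) (eq_proj eq_h) h'm !Bvp /=.
by rewrite scale1r scale0r subr0 addrC subrK.
Qed.

(** A fixed vector is a combination of the old pairs, so it is orthogonal to the new one and the
    added summand vanishes. *)
Lemma proj_fix_succ {F : fieldType} {V : lmodType F} {B : {biscalar V}}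
    {h : nat -> bool -> V} {m : nat} (Hh : hyperbolic B h m.+1) (x : V) :
  proj B h m x = x -> proj B h m.+1 x = x.
Proof.
move=> fix_x; have Bx b : B x (h m b) = 0.
  rewrite -fix_x; apply: proj_perp => i b' im.
  by rewrite Hh ?ltnS ?(ltnW im) // ltn_eqF.
by rewrite /proj big_ord_recr /= !Bx !scale0r subrr addr0.
Qed.

(** If all [u i] were fixed, a combination of them orthogonal to every [h] would equal its own
    projection, which is 0. The count then bounds [#|I|] by the [m.*2] vectors of [h]. *)
Lemma independent_not_fixed {F : fieldType} {V : lmodType F} (B : {biscalar V})
    (h : nat -> bool -> V) (m : nat) {I : finType} (u : I -> V) :
  (forall c : I -> F, \sum_i c i *: u i = 0 -> forall i, c i = 0) ->
  (m.*2 < #|I|)%N -> exists i, proj B h m (u i) != u i.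
Proof.
move=> indep_u ltmI; apply: contrapT => no_i.
have fix_u i : proj B h m (u i) = u i.
  by apply/eqP/negPn/negP => out_i; apply: no_i; exists i.
have := @card_leq_of_pairing _ _ B _ ('I_m * bool)%type u (fun q => h q.1 q.2).
rewrite card_prod card_ord card_bool muln2 leqNgt ltmI /=.
suff H : forall c : I -> F, (forall q : 'I_m * bool,
    B (\sum_i c i *: u i) (h q.1 q.2) = 0) -> forall i, c i = 0 by move/(_ H).
move=> c Hc; apply: indep_u; set x := \sum_i _ in Hc *.
have <- : proj B h m x = x.
  have P0 : proj B h m 0 = 0.
    by rewrite /proj big1 // => i _; rewrite !linear0l !scale0r subrr.
  apply: (closed_sum (fun y => proj B h m y = y)) => // a y z Hy Hz.
  by rewrite proj_linear Hy Hz.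
by rewrite /proj big1 // => i _; rewrite (Hc (i, true)) (Hc (i, false)) !scale0r subrr.
Qed.

(** A combination of the pairs orthogonal to all generators is 0, and pairing it with the partner
    [h j (~~ b)] isolates the coefficient of [h j b] up to sign. *)
Lemma hyperbolic_card {F : fieldType} {V : lmodType F} {B : {biscalar V}}
    {h : nat -> bool -> V} {m : nat} {J : finType} (e : J -> V) :
  symplectic B -> hyperbolic B h m -> generates e -> (m.*2 <= #|J|)%N.
Proof.
move=> sB Hh gen_e; have <- : #|{: 'I_m * bool}| = m.*2.
  by rewrite card_prod card_ord card_bool muln2.
pose u (q : 'I_m * bool) := h q.1 q.2.
apply: (@card_leq_of_pairing _ _ B _ _ u e) => c Hc [j b].
have := linear0l B (h j (~~ b)).
have <- : \sum_q c q *: u q = 0.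
  by apply: (symplectic_eq sB gen_e) => i; rewrite Hc linear0l.
rewrite /u linear_sumlz (bigD1 (j, b)) //= big1 => [|[i b'] ne].
  rewrite linearZl_LR /= Hh // eqxx addr0 => /eqP.
  by case: b => /=; rewrite ?sub0r ?subr0 ?mulrN1 ?mulr1 ?oppr_eq0 => /eqP.
rewrite linearZl_LR /= Hh //; case: eqP => [/val_inj eq_ij|_]; last exact: mulr0.
suff -> : b' = ~~ b by rewrite subrr mulr0.
by move: ne; rewrite eq_ij xpair_eqE eqxx /=; case: b b' => [] [].
Qed.

(** A fixed [e i] is an explicit combination of pairs that occur in [g]. The stage [m] may depend on
    [i], as the infinite case requires. *)
Lemma generates_of_fixed {F : fieldType} {V : lmodType F} (B : {biscalar V})
    {h : nat -> bool -> V} {I J : Type} {e : I -> V} {g : J -> V}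
    (gen_e : generates e) :
  (forall i, exists m, proj B h m (e i) = e i /\
     forall k b, (k < m)%N -> exists j, g j = h k b) -> generates g.
Proof.
move=> He P P0 Plin Pg; apply: gen_e => // i.
have [m [<- Hm]] := He i; rewrite /proj.
have Ph k b : (k < m)%N -> P (h k b) by case/(Hm k b) => j <-.
apply: big_ind => // [x y Px Py|k _]; first by rewrite -[x]scale1r; apply: Plin.
rewrite -scaleNr; apply: (Plin _ _ _ (Ph _ _ _)) => //.
by rewrite -[_ *: _]addr0; apply: Plin => //; apply: Ph.
Qed.

(** * Symplectic bases in finite and in countably infinite dimension *)

Lemma finite_symplectic_basis {F : fieldType} {V : lmodType F}
    {B : {biscalar V}} (k : nat) (e : 'I_k.*2 -> V) :
  symplectic B -> is_basis e ->
  exists h, hyperbolic B h k /\ generates (fun q : 'I_k * bool => h q.1 q.2).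
Proof.
move=> sB [/spanning_generates gen_e indep_e].
have extend h m : (exists i, proj B h m (e i) != e i) -> hyperbolic B h m ->
    exists h', hyperbolic B h' m.+1.
  case=> i out_i Hh; have [p Hp] := hyperbolic_extend sB Hh out_i.
  exists (fun n => if n == m then p else h n).
  by apply: (proj1 (Hp _ _ _)) => [n nm|]; rewrite ?eqxx // ltn_eqF.
have [h Hh] : exists h, hyperbolic B h k.
  suff H : forall m, (m <= k)%N -> exists h, hyperbolic B h m by apply: H.
  elim=> [|m IHm] mk; first by exists (fun _ _ => 0) => i.
  have [h Hh] := IHm (ltnW mk); apply: extend Hh.
  apply: independent_not_fixed => [c Hc i|]; last by rewrite card_ord ltn_double.
  exact: (indep_e (index_enum _) c (index_enum_uniq _) Hc _ (mem_index_enum _)).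
exists h; split=> //; apply: (generates_of_fixed B gen_e) => i; exists k.
split=> [|n b nk]; last by exists (Ordinal nk, b).
(* A basis vector outside the span of the [k] pairs would yield one more pair, against the bound of
   [hyperbolic_card]. *)
apply/eqP/negPn/negP => out_i.
have [|h' Hh'] := extend h k _ Hh; first by exists i.
by have := hyperbolic_card e sB Hh' gen_e; rewrite card_ord leq_double ltnn.
Qed.

Lemma infinite_symplectic_basis {F : fieldType} {V : lmodType F}
    {B : {biscalar V}} (e : nat -> V) :
  symplectic B -> is_basis e ->
  exists h, (forall m, hyperbolic B h m) /\
    generates (fun q : nat * bool => h q.1 q.2).
Proof.
move=> sB [/spanning_generates gen_e indep_e].
(* The first [m.*2.+1] basis vectors are too many to be all fixed. *)
have out h m : exists i, proj B h m (e i) != e i.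
  have [||i out_i] := independent_not_fixed B h m (fun i : 'I_m.*2.+1 => e i).
  - move=> c Hc i; have := indep_e (iota 0 m.*2.+1) (fun j => c (inord j)).
    rewrite -[m.*2.+1 in X in X -> _]subn0 -/(index_iota _ _) iota_uniq big_mkord.
    move/(_ isT) => H; rewrite -(inord_val i); apply: H.
      by rewrite -[RHS]Hc; apply: eq_bigr => j _; rewrite inord_val.
    by rewrite mem_index_iota ltn_ord.
  - by rewrite card_ord.
  - by exists i.
(* The next pair is a function of the list [s] of earlier pairs. The statement is guarded by
   hyperbolicity of [s] so that it holds for every list, as the axiom of choice demands. *)
have step s : exists p, forall m h', size s = m -> hyperbolic B (nth (fun=> 0) s) m ->
    (forall i, (i < m)%N -> h' i = nth (fun=> 0) s i) -> h' m = p ->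
    hyperbolic B h' m.+1 /\ forall k,
      (forall j, (j < k)%N -> proj B (nth (fun=> 0) s) m (e j) = e j) ->
      proj B h' m.+1 (e k) = e k.
  have [Hs|nHs] := pselect (hyperbolic B (nth (fun=> 0) s) (size s)); last first.
    by exists (fun=> 0) => m h' <-.
  have := out (nth (fun=> 0) s) (size s); case/ex_minnP => n out_n min_n.
  have [p Hp] := hyperbolic_extend sB Hs out_n.
  exists p => _ h' <- _ eq_h h'm; have [Hh' fix_n] := Hp h' eq_h h'm.
  (* Here [n] is the least index not yet fixed: smaller indices stay fixed, [n] becomes fixed, and
     for larger ones the assumption fails at [n]. *)
  split=> // k fix_k; have [kn|nk|-> //] := ltngtP k n.
    apply: (proj_fix_succ Hh'); rewrite (eq_proj eq_h).
    by apply/eqP/negPn/negP => /min_n; rewrite leqNgt kn.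
  by move: out_n; rewrite fix_k ?eqxx.
have [f Hf] := choice step.
(* Course-of-values recursion: [s n] lists the first [n] values of [h]. *)
pose s n := iter n (fun t => rcons t (f t)) [::]; pose h n := f (s n).
have sE n : s n = mkseq h n.
  by elim: n => // n IHn; rewrite /s iterS -/(s n) mkseqS -IHn.
have nth_s m i : (i < m)%N -> h i = nth (fun=> 0) (s m) i.
  by move=> im; rewrite sE nth_mkseq.
(* Taking the least unfixed index each time ensures that [m] stages fix at least the first [m] basis
   vectors. *)
have inv m : hyperbolic B h m /\ forall j, (j < m)%N -> proj B h m (e j) = e j.
  elim: m => [|m [Hh fix_h]]; first by split=> // i.
  have size_s : size (s m) = m by rewrite sE size_mkseq.
  have Hs : hyperbolic B (nth (fun=> 0) (s m)) m.
    by apply: eq_hyperbolic Hh => i /nth_s.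
  have [Hh' fix_k] := Hf (s m) m h size_s Hs (nth_s m) erefl.
  split=> // k; rewrite ltnS => km; apply: fix_k => j jk.
  by rewrite -(eq_proj (nth_s m)) fix_h // (leq_trans jk).
exists h; split=> [m|]; first by case: (inv m).
apply: (generates_of_fixed B gen_e) => i; exists i.+1.
by split=> [|n b _]; [apply: (inv _).2 | exists (n, b)].
Qed.

Theorem mainTheorem2 (F : fieldType) (V V' : lmodType F)
    (B : {biscalar V}) (B' : {biscalar V'}) (n r : xdim)
    (hV : symplectic_space B) (hV' : symplectic_space B')
    (hr : r <> Fin 0) (hn : n = xdim_double r)
    (hdim : has_dim V n) (hdim' : has_dim V' n) :
  congruent B B'.
Proof.
have [[_ sB] [_ sB']] := (hV, hV').
case: r hr hn => [k|] _ eq_n; rewrite {}eq_n /= in hdim hdim'.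
  have [[e He] [e' He']] := (hdim, hdim').
  have [h [Hh gen_h]] := finite_symplectic_basis k e sB He.
  have [h' [Hh' gen_h']] := finite_symplectic_basis k e' sB' He'.
  apply: (congruent_of_gram sB sB' gen_h gen_h') => -[i b] [j b'] /=.
  by rewrite Hh // Hh'.
have [[e He] [e' He']] := (hdim, hdim').
have [h [Hh gen_h]] := infinite_symplectic_basis e sB He.
have [h' [Hh' gen_h']] := infinite_symplectic_basis e' sB' He'.
apply: (congruent_of_gram sB sB' gen_h gen_h') => -[i b] [j b'] /=.
(* The initial segment of length [(maxn i j).+1] contains both indices. *)
by rewrite (Hh (maxn i j).+1) ?(Hh' (maxn i j).+1) // ltnS ?leq_maxl ?leq_maxr.
Qed.
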